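(* Let $G$ be a graph without isolated vertices, of order $n$ and size $m$, with $\ell$ leaves and $s$ support vertices. Then $$\gamma_{d}^{oi}(G)\geq\frac{2\delta^{*}(G)\,n-2m+\ell-s}{2\delta^{*}(G)-1}.$$ Furthermore, equality holds if and only if $G\in\Omega$.
   Context: All graphs are finite and simple; membership in families of graphs is up to isomorphism. The size of a graph is its number of edges. A leaf is a vertex of degree one and a support vertex is a neighbor of a leaf; $L(G)$ and $S(G)$ denote the sets of leaves and support vertices of $G$. $N[v]$ denotes the closed neighborhood of $v$. For a graph $G$ without isolated vertices, a double outer-independent dominating set (DOID set) is a set $D\subseteq V(G)$ such that $|N[v]\cap D|\geq 2$ for all $v\in V(G)$ and $V(G)\setminus D$ is independent; the DOID number $\gamma_{d}^{oi}(G)$ is the smallest cardinality of a DOID set of $G$. The number $\delta^{*}(G)$ is the minimum degree (in $G$) taken over all vertices in $V(G)\setminus(L(G)\cup S(G))$ if $L(G)\cup S(G)\neq V(G)$, and $\delta^{*}(G)=2$ if $L(G)\cup S(G)=V(G)$. The family $\Omega$ consists of all graphs $G$ obtained as follows. Choose integers $a,b\geq0$, $r\geq2$ and $p\geq0$ such that $a+b\geq1$ and $2a(r-1)\leq pr$. Begin with $a+b$ pairwise disjoint edges $v_{1}v_{1}',\dots,v_{a}v_{a}',v_{a+1}v_{a+1}',\dots,v_{a+b}v_{a+b}'$. Add $p$ isolated vertices $u_{1},\dots,u_{p}$. Join every vertex $u_{i}$ to exactly $r$ vertices in $A=\{v_{1},v_{1}',\dots,v_{a},v_{a}',v_{a+1},\dots,v_{a+b}\}$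 in such a way that the degree of every vertex in $B=\{v_{1},v_{1}',\dots,v_{a},v_{a}'\}$ is at least $r$. Finally, for each $1\leq i\leq b$, add $k_{a+i}\geq0$ new vertices and join all of them to $v_{a+i}$ by edges. *)

(* Defs.v *)
From mathcomp Require Import all_boot.
Set Implicit Arguments.
Unset Strict Implicit.
Unset Printing Implicit Defensive.

(* A simple graph is a symmetric irreflexive relation [e] on a finType [T]. *)

Section Graph.
Variables (T : finType) (e : rel T).

Definition nbh (x : T) : {set T} := [set y | e x y].
Definition closed_nbh (x : T) : {set T} := x |: nbh x.
Definition deg (x : T) : nat := #|nbh x|.

Definition edges : {set {set T}} := [set [set x; y] | x : T, y : T in nbh x].

Definition leaves : {set T} := [set x | deg x == 1].
Definition supports : {set T} := [set x | [exists y in leaves, e x y]].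

Definition independent (A : {set T}) : bool :=
  [forall x in A, forall y in A, ~~ e x y].

Definition doid (D : {set T}) : bool :=
  [forall v, 2 <= #|closed_nbh v :&: D|] && independent (~: D).

(* When no vertex is isolated [setT] is a DOID set, so that the minimum is
   taken over a nonempty family. *)
Definition doid_number : nat := #|[arg min_(D < setT | doid D) #|D| ]|.

Definition delta_star : nat :=
  if [pick x in ~: (leaves :|: supports)] is Some x0
  then deg [arg min_(x < x0 in ~: (leaves :|: supports)) deg x]
  else 2.

End Graph.

Definition isomorphic (T T' : finType) (e : rel T) (e' : rel T') : Prop :=
  exists2 f : T -> T', bijective f & forall x y, e' (f x) (f y) = e x y.

(* Indices start at 0.  In [Avert a b], [inl (i, false)] is v_i and
   [inl (i, true)] is v_i' for i < a, and [inr i] is v_{a+i} for i < b. *)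
Definition Avert (a b : nat) : finType := ('I_a * bool + 'I_b)%type.

(* The four summands are: the set A; the v_{a+i}' for i < b; the u_i for i < p;
   and, for each i < b, the k i vertices finally attached to v_{a+i}. *)
Definition omega_vert (a b p : nat) (k : 'I_b -> nat) : finType :=
  (Avert a b + 'I_b + 'I_p + {i : 'I_b & 'I_(k i)})%type.

Notation VA x := (inl (inl (inl x))).
Notation VPrime i := (inl (inl (inr i))).
Notation VU u := (inl (inr u)).
Notation VNew w := (inr w).

(* One orientation of each edge; [J u] is the set of vertices of A that u is
   joined to. *)
Definition omega_arc (a b p : nat) (k : 'I_b -> nat)
    (J : 'I_p -> {set Avert a b}) (x y : omega_vert a p k) : bool :=
  match x, y with
  | VA (inl (i, false)), VA (inl (j, true)) => i == j
  | VA (inr i), VPrime j => i == j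
  | VU u, VA z => z \in J u
  | VA (inr i), VNew w => i == tag w
  | _, _ => false
  end.

Definition omega_graph (a b p : nat) (k : 'I_b -> nat)
    (J : 'I_p -> {set Avert a b}) : rel (omega_vert a p k) :=
  fun x y => omega_arc J x y || omega_arc J y x.

Definition Omega (T : finType) (e : rel T) : Prop :=
  exists (a b r p : nat) (k : 'I_b -> nat) (J : 'I_p -> {set Avert a b}),
    [/\ 2 <= r, 1 <= a + b & 2 * a * (r - 1) <= p * r] /\
    [/\ forall u : 'I_p, #|J u| = r,
        forall z : 'I_a * bool, r <= deg (omega_graph (k := k) J) (VA (inl z))
      & isomorphic e (omega_graph (k := k) J)].

(* Main.v *)
Require Import Defs.
From mathcomp Require Import all_boot all_order all_algebra.
From mathcomp Require Import lra zify.
Set Implicit Arguments.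
Unset Strict Implicit.
Unset Printing Implicit Defensive.
Import Order.TTheory GRing.Theory Num.Theory.

(** Let D be a DOID set.  Every leaf, and every support vertex, lies in D, and
the complement of D is independent.  Splitting the degree sum according to
D therefore counts twice each edge leaving D (lemma double_edges):

  2m = sum_(x in D) |N(x) /\ D|  +  2 sum_(x notin D) deg x.

The vertices outside D are neither leaves nor support vertices, so the second
sum is at least |V \ D| delta*.  As for the first sum, a vertex x of D that is
not a support vertex has at least one neighbour in D, and a support vertex has
all its leaves in D; summing over D, and counting every leaf at its unique
neighbour, gives at least l + |D| - s.  Hence

  l + |D| + 2 delta* |V \ D| <= 2m + s        (lemma doid_leqif),

which is the announced bound once n - |D| is substituted for |V \ D|.

Equality holds for D exactly when every vertex outside D has degree delta*,
and D induces a disjoint union of stars in a precise sense: the D-neighbours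
of a support vertex are all leaves, and any other vertex of D has a single
D-neighbour.  The predicate star_split r D records this with an arbitrary
r >= 2 in place of delta*, together with the requirement that no vertex outside
leaves and support vertices has degree below r.  Such a D is automatically a
DOID set, and if it is not the whole vertex set then r = delta*, so the
existence of a star_split characterizes the extremal graphs
(lemma doid_number_bound).

It remains to identify the graphs with a star_split as the family Omega.  In
one direction, the vertices of the model other than the u_i form a star_split,
which is transported along the isomorphism.  In the other, the components of
the graph induced by D are either single edges without leaves or support
vertices (these become the edges v_i v_i' with i <= a) or stars around a
support vertex (with centres the v_i for i > a), while the vertices outside D
become the u_i.  The components with two vertices and no canonical centre are
oriented by the enumeration of the vertex type.  This gives a map place from
the model to the graph; it is shown to be injective, and every edge of the graph
is shown to be the image of an edge of the model.  Since there is no isolated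
vertex, the latter also makes it surjective.  The inequality
2a(r-1) <= pr holds because each of the 2a vertices of B has at least r-1
neighbours outside D, while pr edges leave D. *)

(** * Degree sums and the lower bound *)

Section Counting.

Variables (T : finType) (e : rel T).
Hypotheses (e_sym : symmetric e) (e_irr : irreflexive e).

Implicit Types (x y : T) (A B D : {set T}).

(** Both sides count the ordered pairs of adjacent vertices in [A] times [B]. *)
Lemma sum_nbhI A B :
  \sum_(x in A) #|nbh e x :&: B| = \sum_(y in B) #|nbh e y :&: A|.
Proof.
have card_nbhI x C : #|nbh e x :&: C| = \sum_(y in C) e x y.
  rewrite -sum1_card big_mkcond [RHS]big_mkcond; apply: eq_bigr => y _.
  by rewrite !inE andbC; case: (y \in C) => //; case: (e x y).
under eq_bigr => x _ do rewrite card_nbhI.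
rewrite exchange_big; apply: eq_bigr => y _; rewrite card_nbhI.
by apply: eq_bigr => x _; rewrite e_sym.
Qed.

Lemma sum_deg A : \sum_(x in A) deg e x = \sum_x #|nbh e x :&: A|.
Proof.
transitivity (\sum_(x in A) #|nbh e x :&: setT|).
  by apply: eq_bigr => x _; rewrite setIT.
by rewrite sum_nbhI; apply: eq_bigl => x; rewrite inE.
Qed.

Lemma deg_split A x : deg e x = #|nbh e x :&: A| + #|nbh e x :&: ~: A|.
Proof. by rewrite -setDE cardsID. Qed.

Lemma edgesP E :
  reflect (exists x y, e x y /\ E = [set x; y]) (E \in edges e).
Proof.
apply: (iffP imset2P) => [[x y _]|[x [y [exy ->]]]].
  by rewrite inE => exy ->; exists x, y.
by exists x y; rewrite ?inE.
Qed.

Lemma deg_edges x : deg e x = \sum_(E in edges e) (x \in E).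
Proof.
have inj : {in nbh e x &, injective (fun y => [set x; y])}.
  move=> y z; rewrite !inE => exy exz /setP/(_ y); rewrite !inE eqxx orbT.
  case: eqVneq exy => [->|_ _ /esym/eqP //]; by rewrite e_irr.
rewrite /deg -(card_in_imset inj) -sum1_card big_mkcond [RHS]big_mkcond.
apply: eq_bigr => E _.
have -> : (E \in [set [set x; y] | y in nbh e x]) = (E \in edges e) && (x \in E).
  apply/imsetP/andP=> [[y]|[/edgesP[z [y [ezy ->]]]]].
    rewrite inE => exy ->; rewrite !inE eqxx; split=> //.
    by apply/edgesP; exists x, y.
  rewrite !inE => /orP[] /eqP ->; first by exists y; rewrite ?inE.
  by exists z; rewrite ?inE 1?e_sym // setUC.
by case: (E \in edges e); case: (x \in E).
Qed.

(** Exchanging the sums over vertices and incident edges leaves the number of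
endpoints of each edge, which is two. *)
Lemma handshake : \sum_x deg e x = 2 * #|edges e|.
Proof.
under eq_bigr => x _ do rewrite deg_edges.
rewrite exchange_big mulnC -sum_nat_const; apply: eq_bigr => E /edgesP.
move=> [x [y [exy ->]]]; rewrite -big_mkcond sum1_card cards2.
by case: eqVneq exy => // ->; rewrite e_irr.
Qed.

Lemma leafP x y : x \in leaves e -> e x y -> nbh e x = [set y].
Proof.
rewrite inE => /cards1P[z def_x] exy.
have : y \in nbh e x by rewrite inE.
by rewrite def_x inE => /eqP ->.
Qed.

Lemma supportsP x : reflect (exists2 y, y \in leaves e & e x y) (x \in supports e).
Proof. by rewrite inE; apply: exists_inP. Qed.

Lemma supports_nbh x : (x \in supports e) = (0 < #|nbh e x :&: leaves e|).
Proof.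
apply/supportsP/card_gt0P=> [[y ly exy]|[y]].
  by exists y; rewrite in_setI ly inE exy.
by rewrite in_setI inE => /andP[]; exists y.
Qed.

Lemma independentP A x : independent e (~: A) -> x \notin A -> nbh e x \subset A.
Proof.
move=> /forall_inP indA xA; apply/subsetP=> y; rewrite inE => exy.
apply: contraTT exy => yA.
have /indA/forall_inP-> // : x \in ~: A by rewrite inE.
by rewrite inE.
Qed.

Lemma doid_nbh D x : doid e D -> x \in D -> exists2 y, y \in D & e x y.
Proof.
move=> /andP[/forallP/(_ x) domD _] xD.
move: domD; rewrite (cardsD1 x) !inE eqxx xD ltnS => /card_gt0P[y].
by rewrite !inE => /andP[/negPf->] /andP[]; exists y.
Qed.

Lemma doid_leaves D : doid e D -> leaves e \subset D.
Proof.
move=> /andP[/forallP domD _]; apply/subsetP=> x; rewrite inE => /eqP deg1.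
apply: contraLR (domD x) => xD; rewrite -ltnNge ltnS -deg1 subset_leq_card //.
apply/subsetP=> y; rewrite !inE; case: eqVneq => [->|_] /andP[//].
by rewrite (negPf xD).
Qed.

(** The second element of [D] in the closed neighbourhood of a leaf can only be
its support vertex. *)
Lemma doid_supports D : doid e D -> supports e \subset D.
Proof.
move=> doidD; apply/subsetP=> x /supportsP[y ly exy].
have [z zD eyz] := doid_nbh doidD (subsetP (doid_leaves doidD) y ly).
have : x \in nbh e y by rewrite inE e_sym.
by rewrite (leafP ly eyz) inE => /eqP->.
Qed.

(** The shape of the component of [x] in the graph induced by [D] when the
estimate at [x] is an equality. *)
Definition star_at D x :=
  if x \in supports e then nbh e x :&: D \subset leaves e
  else #|nbh e x :&: D| == 1.

(** A vertex that is not a support vertex has no leaf neighbour but has a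
neighbour in [D]; for a support vertex the inequality is the inclusion of its
leaves in its neighbourhood inside [D].  Adding the support indicator makes one
statement out of the two cases, which can be summed over [D]. *)
Lemma star_at_leqif D x : doid e D -> x \in D ->
  #|nbh e x :&: leaves e| + 1 <= #|nbh e x :&: D| + (x \in supports e)
  ?= iff star_at D x.
Proof.
move=> doidD xD; rewrite /star_at; have LD := doid_leaves doidD.
case: ifPn => [_|]; last first.
  rewrite supports_nbh lt0n negbK => /eqP ->; rewrite addn0 add0n.
  have [y yD exy] := doid_nbh doidD xD; split; last exact: eq_sym.
  by apply/card_gt0P; exists y; rewrite !inE exy.
apply/leqifP; have sub := setIS (nbh e x) LD.
have [eqI|neqI] := ifPn; last first.
  rewrite ltn_add2r proper_card // properE sub; apply: contra neqI.
  by move/subset_trans; apply; apply: subsetIr.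
rewrite eqn_add2r (_ : _ :&: _ = nbh e x :&: D) //.
by apply/eqP; rewrite eqEsubset sub subsetI subsetIl.
Qed.

Lemma sum_leaf_nbh D : supports e \subset D ->
  \sum_(x in D) #|nbh e x :&: leaves e| = #|leaves e|.
Proof.
move=> SD; rewrite -sum1_card.
transitivity (\sum_(x in leaves e) deg e x); last first.
  by apply: eq_bigr => x; rewrite inE => /eqP.
rewrite sum_deg big_mkcond; apply: eq_bigr => x _; case: ifPn => // xD.
by apply/esym/eqP; rewrite -leqn0 leqNgt -supports_nbh (contra (subsetP SD x)).
Qed.

(** As the complement of [D] is independent, the degree of a vertex outside
[D] is the number of edges that it sends into [D], so the part of the degrees
in [D] that leaves [D] sums to the degrees outside [D]. *)
Lemma double_edges D : independent e (~: D) ->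
  2 * #|edges e| =
  \sum_(x in D) #|nbh e x :&: D| + 2 * \sum_(x in ~: D) deg e x.
Proof.
move=> indD; rewrite -handshake (bigID (mem D)) /=.
under eq_bigr => x _ do rewrite (deg_split D).
rewrite big_split /= sum_nbhI mul2n -addnn addnA; congr (_ + _ + _).
  apply: eq_bigr => x; rewrite inE => xD.
  by rewrite /deg (setIidPl _) // independentP.
by apply: eq_bigl => x; rewrite inE.
Qed.

(** The vertices over which [delta_star] is a minimum. *)
Definition exposed : {set T} := ~: (leaves e :|: supports e).

Lemma delta_star_min x : x \in exposed -> delta_star e <= deg e x.
Proof.
rewrite /delta_star -/exposed => xE; case: pickP => [x0 x0E|/(_ x)]; last by rewrite xE.
by case: arg_minnP => // y yE; apply.
Qed.

Lemma delta_star_attained x : x \in exposed ->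
  exists2 y, y \in exposed & delta_star e = deg e y.
Proof.
rewrite /delta_star -/exposed => xE; case: pickP => [x0 x0E|/(_ x)]; last by rewrite xE.
by case: arg_minnP => // y yE _; exists y.
Qed.

Lemma doid_exposed D : doid e D -> ~: D \subset exposed.
Proof. by move=> doidD; rewrite setCS subUset doid_leaves ?doid_supports. Qed.

Hypothesis no_isolated : forall x, 0 < deg e x.

Lemma exposed_deg x : x \in exposed -> 1 < deg e x.
Proof.
rewrite !inE negb_or => /andP[degN1 _].
by rewrite ltn_neqAle eq_sym degN1 no_isolated.
Qed.

Lemma delta_star_gt1 : 1 < delta_star e.
Proof.
rewrite /delta_star; case: pickP => [x0 x0E|//].
by case: arg_minnP => // y yE _; apply: exposed_deg.
Qed.

Lemma doid_setT : doid e setT.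
Proof.
apply/andP; split.
  apply/forallP=> x; rewrite setIT /closed_nbh cardsU1 inE e_irr.
  by have := no_isolated x; rewrite /deg; case: #|_|.
by apply/forall_inP=> x; rewrite !inE.
Qed.

Lemma doid_number_min D : doid e D -> doid_number e <= #|D|.
Proof.
by rewrite /doid_number; case: arg_minnP => [|D0 _]; [apply: doid_setT | apply].
Qed.

Lemma doid_number_attained : exists2 D, doid e D & doid_number e = #|D|.
Proof.
by rewrite /doid_number; case: arg_minnP => [|D0 ? _]; [apply: doid_setT | exists D0].
Qed.

Definition tight D :=
  [forall x in D, star_at D x] && [forall x in ~: D, delta_star e == deg e x].

(** The sum of the local estimates [star_at_leqif] over [D] and of the bounds
by [delta_star] over the complement, where the latter count twice; each local
estimate must be an equality for the sum to be one. *)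
Lemma doid_leqif D : doid e D ->
  #|leaves e| + #|D| + 2 * (#|~: D| * delta_star e)
    <= 2 * #|edges e| + #|supports e| ?= iff tight D.
Proof.
move=> doidD; have /andP[_ indD] := doidD.
have SD := doid_supports doidD; have LD := doid_leaves doidD.
have inner := leqif_sum (fun x (xD : x \in D) => star_at_leqif doidD xD).
rewrite !big_split /= sum_leaf_nbh // sum1_card in inner.
have {inner} : #|leaves e| + #|D| <=
    \sum_(x in D) #|nbh e x :&: D| + #|supports e| ?= iff [forall x in D, star_at D x].
  congr (_ <= _ + _ ?= iff _) : inner.
  rewrite -sum1_card big_mkcond [RHS]big_mkcond; apply: eq_bigr => x _.
  by case: ifPn => [_|xD]; [case: ifP | rewrite ifN // (contra (subsetP SD x))].
have outer := leqif_sum (fun x (xD : x \in ~: D) =>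
  leqif_eq (delta_star_min (subsetP (doid_exposed doidD) x xD))).
rewrite sum_nat_const in outer.
move=> /leqif_add/(_ (leqif_add outer outer)); rewrite andbb.
by rewrite (double_edges indD) !mul2n -!addnn (addnAC _ _ #|supports e|).
Qed.

End Counting.

(** * Extremal sets as decompositions into stars *)

Section StarSplit.

Variables (T : finType) (e : rel T).
Hypotheses (e_sym : symmetric e) (e_irr : irreflexive e).

Implicit Types (x y : T) (D : {set T}).

(** The parameter [r] is free because the family [Omega] does not mention
[delta_star]: for [D = setT] any [r] not exceeding the degrees outside leaves
and support vertices fits, and otherwise [r] is forced to be [delta_star]. *)
Definition star_split r D :=
  [/\ independent e (~: D), {in D, forall x, star_at e D x},
      {in ~: D, forall x, deg e x = r} & {in exposed e, forall x, r <= deg e x}].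

(** A vertex outside [D] has at least two neighbours, all in [D]; in
particular leaves are in [D], which gives a support vertex of [D] a neighbour
in [D], as the other vertices of [D] have by [star_at]. *)
Lemma star_split_doid r D : 1 < r -> star_split r D -> doid e D.
Proof.
move=> r_gt1 [indD starD degC _]; apply/andP; split=> //.
have LD : leaves e \subset D.
  apply/subsetP=> x; rewrite inE; apply: contraLR => xD.
  by rewrite degC ?inE // gtn_eqF.
apply/forallP=> x; have [xD|xD] := boolP (x \in D); last first.
  rewrite (leq_trans r_gt1) // -(degC x) ?inE // subset_leq_card //.
  apply/subsetP=> y yx; rewrite !inE (subsetP (independentP indD xD)) // andbT.
  by move: yx; rewrite inE => ->; rewrite orbT.
have [y] : exists y, y \in nbh e x :&: D.
  apply/card_gt0P; move: (starD x xD); rewrite /star_at.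
  case: ifPn => [|_ /eqP-> //]; rewrite supports_nbh => lx _.
  exact: leq_trans lx (subset_leq_card (setIS _ LD)).
rewrite !inE => /andP[exy yD]; rewrite (cardsD1 x) !inE eqxx xD ltnS.
apply/card_gt0P; exists y; rewrite !inE exy yD orbT !andbT.
by apply: contraTneq exy => ->; rewrite e_irr.
Qed.

(** A vertex outside [D] is counted in the minimum [delta_star] and attains
the lower bound [r], so that [r = delta_star] as soon as there is one. *)
Lemma star_split_tight r D : 1 < r -> star_split r D -> tight e D.
Proof.
move=> r_gt1 splitD; have doidD := star_split_doid r_gt1 splitD.
have [_ starD degC degE] := splitD; apply/andP; split; apply/forall_inP=> // x xD.
have xE := subsetP (doid_exposed e_sym doidD) x xD.
rewrite eqn_leq delta_star_min // degC //.
by have [y yE ->] := delta_star_attained xE; apply: degE.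
Qed.

Lemma tight_star_split D : doid e D -> tight e D -> star_split (delta_star e) D.
Proof.
move=> /andP[_ indD] /andP[/forall_inP starD /forall_inP degC]; split=> //.
  by move=> x xD; rewrite (eqP (degC x xD)).
by move=> x; apply: delta_star_min.
Qed.

Hypothesis no_isolated : forall x, 0 < deg e x.

Local Open Scope ring_scope.

Theorem doid_number_bound :
  let n : rat := #|T|%:R in
  let m : rat := #|edges e|%:R in
  let l : rat := #|leaves e|%:R in
  let s : rat := #|supports e|%:R in
  let d : rat := (delta_star e)%:R in
  let gamma : rat := (doid_number e)%:R in
  gamma >= (2 * d * n - 2 * m + l - s) / (2 * d - 1) /\
  (gamma = (2 * d * n - 2 * m + l - s) / (2 * d - 1) <->
   exists r D, (1 < r)%N /\ star_split r D).
Proof.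
move=> n m l s d gamma.
have d_gt1 : 1 < d by rewrite ltr1n delta_star_gt1.
have den_gt0 : 0 < 2 * d - 1 by lra.
have cast D : n = #|D|%:R + #|~: D|%:R by rewrite -natrD cardsC.
have bound D : doid e D ->
    (2 * d * n - 2 * m + l - s <= #|D|%:R * (2 * d - 1)) *
    ((2 * d * n - 2 * m + l - s == #|D|%:R * (2 * d - 1)) = tight e D).
  move=> doidD; have [leD eqD] := doid_leqif e_sym e_irr doidD.
  split; [move: leD|rewrite -eqD].
    rewrite -(ler_nat rat) !(natrD, natrM) (cast D) -/m -/l -/s -/d; lra.
  rewrite -(eqr_nat rat) !(natrD, natrM) (cast D) -/m -/l -/s -/d.
  by apply/eqP/eqP; lra.
have [D doidD gammaE] := doid_number_attained e_irr no_isolated.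
have [leD eqD] := bound D doidD; rewrite -gammaE -/gamma in leD eqD.
split; first by rewrite ler_pdivrMr.
split=> [eqg|[r [D' [r_gt1 splitD']]]].
  exists (delta_star e), D; split; first exact: delta_star_gt1.
  apply: tight_star_split => //; rewrite -eqD {1}eqg divfK ?eqxx //.
  exact: lt0r_neq0.
have doidD' := star_split_doid r_gt1 splitD'.
have [_] := bound D' doidD'; rewrite (star_split_tight r_gt1 splitD') => /eqP eqD'.
apply: le_anti; rewrite ler_pdivrMr // leD andbT ler_pdivlMr // eqD'.
by rewrite ler_pM2r // ler_nat doid_number_min.
Qed.

End StarSplit.

(** * The graphs of the family Omega have a decomposition into stars *)

Section OmegaIsSplit.

Variables (a b r p : nat) (k : 'I_b -> nat) (J : 'I_p -> {set Avert a b}).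
Hypotheses (r_gt1 : 1 < r) (cardJ : forall u, #|J u| = r).

Let G : rel (omega_vert a p k) := omega_graph (k := k) J.

Hypothesis degB : forall z : 'I_a * bool, r <= deg G (VA (inl z)).

(** All vertices but the u_i. *)
Definition omega_core : {set omega_vert a p k} :=
  [set x : omega_vert a p k | if x is VU _ then false else true].

Lemma omega_degU u : deg G (VU u) = r.
Proof.
rewrite -(cardJ u) -(card_imset (f := fun z => VA z : omega_vert a p k)).
  2: by move=> z1 z2 [].
apply: eq_card => -[[[z|j]|u']|w]; rewrite !inE /G /omega_graph; last 3 first.
- by apply/esym/imsetP => -[].
- by apply/esym/imsetP => -[].
- by apply/esym/imsetP => -[].
have -> : omega_arc (k := k) J (VA z) (VU u) = false by case: z => [[i []]|].
rewrite orbF; apply/idP/imsetP=> [zJ|[z' zJ [->]] //]; by exists z.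
Qed.

Lemma omega_nbhPrime i : nbh G (VPrime i) = [set VA (inr i)].
Proof.
by apply/setP=> -[[[[[j []]|j]|j]|u]|w]; rewrite !inE /G /omega_graph.
Qed.

Lemma omega_nbhNew w : nbh G (VNew w) = [set VA (inr (tag w))].
Proof.
by apply/setP=> -[[[[[j []]|j]|j]|u]|w']; rewrite !inE /G /omega_graph.
Qed.

Lemma omega_leafPrime i : VPrime i \in leaves G.
Proof. by rewrite inE /deg omega_nbhPrime cards1. Qed.

Lemma omega_leafNew w : VNew w \in leaves G.
Proof. by rewrite inE /deg omega_nbhNew cards1. Qed.

Lemma omega_supportA i : VA (inr i) \in supports G.
Proof.
by apply/supportsP; exists (VPrime i); rewrite ?omega_leafPrime // /G /omega_graph /= eqxx.
Qed.

Lemma omega_nonleaf x : r <= deg G x -> x \notin leaves G.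
Proof. by move=> deg_x; rewrite inE gtn_eqF // (leq_trans r_gt1). Qed.

(** The neighbours of a vertex of B are its partner, also in B, and vertices
u_i; all have degree at least [r]. *)
Lemma omega_nonsupportB z : VA (inl z) \notin supports G.
Proof.
apply/supportsP=> -[[[[[z'|i]|i]|u]|w]]; last 4 first.
- by case: z => i' [].
- by case: z => i' [].
- by rewrite (negPf (omega_nonleaf _)) ?omega_degU.
- by case: z => i' [].
by rewrite (negPf (omega_nonleaf _)).
Qed.

Lemma omega_partnerB i c :
  nbh G (VA (inl (i, c))) :&: omega_core = [set VA (inl (i, ~~ c))].
Proof.
apply/setP=> -[[[[[j c']|j]|j]|u]|w]; rewrite !inE /G /omega_graph ?andbF //=.
  by case: c; case: c' => //=; rewrite ?orbF ?andbT ?andbF;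
    apply/idP/eqP => [|[]] // => [/eqP->|->].
all: by case: c.
Qed.

(** A pendant vertex is a support vertex only when its neighbour is a leaf,
that is when they form a component of order two. *)
Lemma star_at_pendant (x : omega_vert a p k) i :
  nbh G x = [set VA (inr i)] -> star_at G omega_core x.
Proof.
move=> nbh_x; have sub : nbh G x \subset omega_core by rewrite nbh_x sub1set inE.
rewrite /star_at (setIidPl sub) nbh_x cards1 sub1set; case: ifP => // /supportsP[y ly].
have Gx z : G x z = (z \in nbh G x) by rewrite inE.
by rewrite Gx nbh_x inE => /eqP <-.
Qed.

Lemma omega_split : star_split G r omega_core.
Proof.
split.
- apply/forall_inP=> -[[[z|j]|u]|w]; rewrite !inE //= => _.
  by apply/forall_inP=> -[[[z|j]|u']|w]; rewrite !inE.
- move=> [[[[[i c]|i]|i]|u]|w]; rewrite !inE //= => _.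
  + by rewrite /star_at (negPf (omega_nonsupportB _)) omega_partnerB cards1.
  + rewrite /star_at omega_supportA; apply/subsetP=> y; rewrite !in_setI => /andP[].
    case: y => [[[[[j []]|j]|j]|u]|w]; rewrite ?omega_leafPrime ?omega_leafNew //;
      by rewrite !inE ?andbF.
  + exact: star_at_pendant (omega_nbhPrime i).
  + exact: star_at_pendant (omega_nbhNew w).
- by move=> [[[z|j]|u]|w]; rewrite !inE //= omega_degU.
move=> [[[[z|i]|i]|u]|w]; rewrite in_setC in_setU.
- by move=> _; apply: degB.
- by rewrite omega_supportA orbT.
- by rewrite omega_leafPrime.
- by rewrite omega_degU.
by rewrite omega_leafNew.
Qed.

End OmegaIsSplit.

Section Transport.

Variables (T T' : finType) (e : rel T) (e' : rel T') (f : T -> T').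
Hypotheses (f_bij : bijective f) (f_mor : forall x y, e' (f x) (f y) = e x y).

Lemma card_preim (A : {set T'}) : #|f @^-1: A| = #|A|.
Proof.
by apply: on_card_preimset; have [g fK gK] := f_bij; exists g => y _; rewrite ?fK ?gK.
Qed.

Lemma nbh_preim x : nbh e x = f @^-1: nbh e' (f x).
Proof. by apply/setP=> y; rewrite !inE f_mor. Qed.

Lemma deg_preim x : deg e x = deg e' (f x).
Proof. by rewrite /deg nbh_preim card_preim. Qed.

Lemma leaves_preim : leaves e = f @^-1: leaves e'.
Proof. by apply/setP=> x; rewrite !inE deg_preim. Qed.

Lemma supports_preim : supports e = f @^-1: supports e'.
Proof.
have [g fK gK] := f_bij; apply/setP=> x; rewrite [RHS]inE; apply/supportsP/supportsP.
  by move=> [y ly exy]; exists (f y); rewrite ?f_mor //; move: ly; rewrite leaves_preim inE.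
move=> [y ly exy]; exists (g y); last by rewrite -f_mor gK.
by rewrite leaves_preim inE gK.
Qed.

Lemma star_split_preim r (D : {set T'}) : star_split e' r D -> star_split e r (f @^-1: D).
Proof.
move=> [/forall_inP indD starD degC degE]; split.
- apply/forall_inP=> x; rewrite !inE => xD; apply/forall_inP=> y; rewrite !inE => yD.
  have /indD/forall_inP/(_ (f y)) : f x \in ~: D by rewrite inE.
  by rewrite f_mor inE; apply.
- move=> x; rewrite inE => /starD; rewrite /star_at supports_preim [x \in _]inE nbh_preim.
  rewrite -preimsetI card_preim leaves_preim; case: ifP => // _.
  exact: preimsetS.
- by move=> x; rewrite !inE deg_preim => xD; rewrite degC ?inE.
move=> x; rewrite /exposed leaves_preim supports_preim -preimsetU -preimsetC inE deg_preim.
exact: degE.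
Qed.

End Transport.

Lemma Omega_star_split (T : finType) (e : rel T) :
  Omega e -> exists r D, 1 < r /\ star_split e r D.
Proof.
move=> [a [b [r [p [k [J [[r_gt1 _ _] [cardJ degB [f f_bij f_mor]]]]]]]]].
exists r, (f @^-1: @omega_core a b p k); split=> //.
exact/(star_split_preim f_bij f_mor)/omega_split.
Qed.

(** * Graphs with a decomposition into stars belong to Omega *)

Section SplitIsOmega.

Variables (T : finType) (e : rel T) (r : nat) (D : {set T}).
Hypotheses (e_sym : symmetric e) (e_irr : irreflexive e).
Hypotheses (no_isolated : forall x, 0 < deg e x).
Hypotheses (r_gt1 : 1 < r) (splitD : star_split e r D).

Implicit Types (x y c : T).

Let doidD : doid e D := star_split_doid e_irr r_gt1 splitD.
Let leaf_in x : x \in leaves e -> x \in D := subsetP (doid_leaves doidD) x.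
Let support_in x : x \in supports e -> x \in D :=
  subsetP (doid_supports e_sym doidD) x.

(** Some neighbour in [D].  It is unique except at a support vertex with
several leaves, where the choice singles out the leaf that will be v_i'. *)
Definition partner x := odflt x [pick y in nbh e x :&: D].

Lemma partnerP x : x \in D -> e x (partner x) /\ partner x \in D.
Proof.
move=> xD; rewrite /partner; case: pickP => [y|].
  by rewrite !inE => /andP[].
by have [y yD exy] := doid_nbh doidD xD => /(_ y); rewrite !inE exy yD.
Qed.

Lemma leaf_partner x y : x \in leaves e -> e x y -> partner x = y.
Proof.
move=> lx exy; have [exp _] := partnerP (leaf_in lx).
have : partner x \in nbh e x by rewrite inE.
by rewrite (leafP lx exy) inE => /eqP.
Qed.

Lemma nonsupport_partner x y :
  x \in D -> x \notin supports e -> y \in D -> e x y -> partner x = y.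
Proof.
move=> xD xS yD exy; have [_ /(_ x xD) + _ _] := splitD.
rewrite /star_at (negPf xS) => /cards1P[z nbhx]; have [exp pD] := partnerP xD.
have : partner x \in nbh e x :&: D by rewrite !inE exp.
have : y \in nbh e x :&: D by rewrite !inE exy.
by rewrite nbhx !inE => /eqP-> /eqP.
Qed.

Lemma support_nbh x y : x \in supports e -> y \in D -> e x y -> y \in leaves e.
Proof.
move=> xS yD exy; have [_ /(_ x (support_in xS)) + _ _] := splitD.
by rewrite /star_at xS => /subsetP; apply; rewrite !inE exy.
Qed.

Lemma leaf_support x y : x \in leaves e -> e x y -> y \in supports e.
Proof. by move=> lx exy; apply/supportsP; exists x; rewrite // e_sym. Qed.

Definition matched : {set T} := D :\: (leaves e :|: supports e).

Lemma matchedP x :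
  reflect [/\ x \in D, x \notin leaves e & x \notin supports e] (x \in matched).
Proof. by rewrite in_setD in_setU negb_or andbC; apply: (iffP and3P) => -[]. Qed.

(** A partner of a matched vertex that were a leaf or a support vertex would
make that matched vertex a support vertex or a leaf, respectively. *)
Lemma matched_partner x : x \in matched ->
  partner x \in matched /\ partner (partner x) = x.
Proof.
move=> /matchedP[xD xL xS]; have [exp pD] := partnerP xD.
have pS : partner x \notin supports e.
  by apply: contra xL => /support_nbh; apply; rewrite // e_sym.
split; last by apply: nonsupport_partner; rewrite // e_sym.
apply/matchedP; split=> //; apply: contra xS => /leaf_support; apply.
by rewrite e_sym.
Qed.

(** Orients the pairs of vertices that are partners of each other. *)
Definition lower x := enum_rank x < enum_rank (partner x).

Definition matched_lower : {set T} := [set x in matched | lower x].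

(** In a component of order two both vertices are leaves and support vertices;
[lower] selects one of them. *)
Definition centers : {set T} := [set x in supports e | (x \notin leaves e) || lower x].

Lemma lower_partner x : x \in D -> partner (partner x) = x ->
  lower (partner x) = ~~ lower x.
Proof.
move=> xD ppx; rewrite /lower ppx -leqNgt ltn_neqAle.
case: eqP => // /ord_inj/enum_rank_inj pxx.
by have [] := partnerP xD; rewrite pxx e_irr.
Qed.

(** If the leaf [y] were itself a center then [c] and [y] would form a component
of order two in which both are [lower]. *)
Lemma center_nbh c y : c \in centers -> y \in D -> e c y ->
  [/\ y \in leaves e, y \notin centers & partner y = c].
Proof.
rewrite inE => /andP[cS c_lo] yD ecy; have ly := support_nbh cS yD ecy.
have py : partner y = c by apply: leaf_partner; rewrite // e_sym.
split=> //; rewrite inE ly /=; apply/andP=> -[yS lo_y].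
have lc : c \in leaves e by apply: support_nbh yS _ _; rewrite ?support_in // e_sym.
move: c_lo; rewrite lc /= -py lower_partner ?lo_y //.
by rewrite py; apply: leaf_partner.
Qed.

Lemma leaf_center x : x \in leaves e -> x \notin centers -> partner x \in centers.
Proof.
move=> lx; have [exp pD] := partnerP (leaf_in lx); have pS := leaf_support lx exp.
rewrite ![_ \in centers]inE pS lx /=.
have [lp|//] := boolP (partner x \in leaves e).
have xS : x \in supports e by apply: leaf_support lp _; rewrite e_sym.
have ppx : partner (partner x) = x by apply: leaf_partner; rewrite // e_sym.
by rewrite xS lower_partner ?leaf_in.
Qed.

Definition extra_leaves c : {set T} := (nbh e c :&: D) :\ partner c.

Local Notation a := #|matched_lower|.
Local Notation b := #|centers|.
Local Notation p := #|~: D|.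

Definition extra (i : 'I_b) := #|extra_leaves (enum_val i)|.

Definition place (x : omega_vert a p extra) : T :=
  match x with
  | VA (inl (i, false)) => enum_val i
  | VA (inl (i, true)) => partner (enum_val i)
  | VA (inr i) => enum_val i
  | VPrime i => partner (enum_val i)
  | VU u => enum_val u
  | VNew w => enum_val (tagged w)
  end.

Definition attach (u : 'I_p) : {set Avert a b} :=
  [set z | e (enum_val u) (place (VA z))].

Local Notation G := (omega_graph (k := extra) attach).

Lemma enum_matchedP (i : 'I_a) :
  [/\ enum_val i \in matched, enum_val i \in D & lower (enum_val i)].
Proof.
by have := enum_valP i; rewrite inE => /andP[iM ilo]; have [] := matchedP _ iM.
Qed.

Lemma enum_center_in (i : 'I_b) : enum_val i \in D.
Proof. by have := enum_valP i; rewrite inE => /andP[/support_in]. Qed.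

Lemma enum_extraP (i : 'I_b) (w : 'I_(extra i)) :
  [/\ e (enum_val i) (enum_val w), enum_val w \in D & enum_val w != partner (enum_val i)].
Proof. by have := enum_valP w; rewrite !inE => /and3P[]. Qed.

Lemma place_arc (x y : omega_vert a p extra) : omega_arc attach x y -> e (place x) (place y).
Proof.
case: x => [[[[[i []]|i]|i]|u]|w] //; case: y => [[[[[j []]|j]|j]|v]|[j w]] //=.
- by move/eqP <-; apply: (partnerP _).1; have [] := enum_matchedP i.
- by move/eqP <-; apply: (partnerP _).1; apply: enum_center_in.
- by move/eqP ->; have [] := enum_extraP w.
- by rewrite inE.
- by rewrite inE.
- by rewrite inE.
Qed.

Lemma place_graph (x y : omega_vert a p extra) : G x y -> e (place x) (place y).
Proof. by case/orP=> /place_arc //; rewrite e_sym. Qed.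

(** Which of the six kinds of model vertices is placed at [y], recovered from
the graph alone: this reduces the injectivity of [place] to each kind. *)
Definition role y : nat :=
  if y \notin D then 0 else
  if y \in matched then if lower y then 1 else 2 else
  if y \in centers then 3 else
  if partner (partner y) == y then 4 else 5.

Lemma role_place (x : omega_vert a p extra) :
  role (place x) = match x with
    | VU _ => 0 | VA (inl (_, false)) => 1 | VA (inl (_, true)) => 2
    | VA (inr _) => 3 | VPrime _ => 4 | VNew _ => 5
  end.
Proof.
rewrite /role; case: x => [[[[[i []]|i]|i]|u]|[i w]] /=.
- have [iM iD lo_i] := enum_matchedP i; have [piM ppi] := matched_partner iM.
  by rewrite (partnerP iD).2 piM lower_partner ?lo_i.
- by have [-> -> ->] := enum_matchedP i.
- rewrite enum_center_in (enum_valP i) ifF //; apply/matchedP=> -[_ _].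
  by have := enum_valP i; rewrite [_ \in centers]inE => /andP[->].
- have [ep pD] := partnerP (enum_center_in i).
  have [lp /negPf-> ->] := center_nbh (enum_valP i) pD ep.
  by rewrite pD eqxx ifF //; apply/matchedP=> -[_]; rewrite lp.
- by have := enum_valP u; rewrite inE => ->.
have [ei wD neq_w] := enum_extraP w.
have [lw /negPf-> pw] := center_nbh (enum_valP i) wD ei.
rewrite wD pw eq_sym (negPf neq_w) ifF //; apply/matchedP=> -[_].
by rewrite lw.
Qed.

Lemma place_inj : injective place.
Proof.
move=> x y eq_xy; have := congr1 role eq_xy; rewrite !role_place; move: eq_xy.
case: x => [[[[[i []]|i]|i]|u]|[i w]]; case: y => [[[[[j []]|j]|j]|v]|[j w']] //= eq_xy _.
- have [iM _ _] := enum_matchedP i; have [jM _ _] := enum_matchedP j.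
  have := congr1 partner eq_xy.
  by rewrite (matched_partner iM).2 (matched_partner jM).2 => /enum_val_inj->.
- by rewrite (enum_val_inj eq_xy).
- by rewrite (enum_val_inj eq_xy).
- have [ei iD] := partnerP (enum_center_in i); have [ej jD] := partnerP (enum_center_in j).
  have [_ _ ppi] := center_nbh (enum_valP i) iD ei.
  have [_ _ ppj] := center_nbh (enum_valP j) jD ej.
  by move: (congr1 partner eq_xy); rewrite ppi ppj => /enum_val_inj->.
- by rewrite (enum_val_inj eq_xy).
have [ei wD _] := enum_extraP w; have [ej wD' _] := enum_extraP w'.
have [_ _ pw] := center_nbh (enum_valP i) wD ei.
have [_ _ pw'] := center_nbh (enum_valP j) wD' ej.
have eq_ij : i = j by apply: enum_val_inj; rewrite -pw -pw' eq_xy.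
by case: j / eq_ij w' eq_xy {ej wD' pw'} => w' /enum_val_inj->.
Qed.

Lemma enum_val_ex (A : {set T}) x : x \in A -> exists i : 'I_#|A|, enum_val i = x.
Proof. by move=> xA; exists (enum_rank_in xA x); rewrite enum_rankK_in. Qed.

Lemma place_matched_center y :
  y \in matched \/ y \in centers -> exists z, place (VA z) = y.
Proof.
case=> [yM|/enum_val_ex[i <-]]; last by exists (inr i).
have [lo_y|lo_y] := boolP (lower y).
  have /enum_val_ex[i <-] : y \in matched_lower by rewrite inE yM.
  by exists (inl (i, false)).
have [pyM ppy] := matched_partner yM; have [yD _ _] := matchedP _ yM.
have /enum_val_ex[i eq_i] : partner y \in matched_lower by rewrite inE pyM lower_partner.
by exists (inl (i, true)); rewrite /= eq_i.
Qed.

(** A leaf adjacent to [x] would make [x] a support vertex, hence a member of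
[D]. *)
Lemma outside_nbh x y : x \notin D -> e x y -> y \in matched \/ y \in centers.
Proof.
move=> xD exy; have [indD _ _ _] := splitD.
have yD : y \in D by apply: (subsetP (independentP indD xD)); rewrite inE.
have yL : y \notin leaves e.
  by apply: contra xD => /leaf_support/(_ _)/support_in; apply; rewrite e_sym.
have [yS|yS] := boolP (y \in supports e); first by right; rewrite inE yS yL.
by left; apply/matchedP.
Qed.

Lemma place_oriented x y : e x y ->
    x \notin D \/ y \in D /\ (x \in matched_lower \/ x \in centers) ->
  exists v w, [/\ place v = x, place w = y & omega_arc attach v w].
Proof.
move=> exy [xD|[yD [/[dup] xM0|/[dup] xC]]].
- have [z eq_z] := place_matched_center (outside_nbh xD exy).
  have /enum_val_ex[u eq_u] : x \in ~: D by rewrite inE.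
  by exists (VU u), (VA z); split=> //=; rewrite inE eq_u eq_z.
- rewrite inE => /andP[/matchedP[xD _ xS] _]; have [i eq_i] := enum_val_ex xM0.
  exists (VA (inl (i, false))), (VA (inl (i, true))); split=> //=.
  by rewrite eq_i; apply: nonsupport_partner.
move=> _; have [i eq_i] := enum_val_ex xC.
have [py|py] := eqVneq y (partner x).
  by exists (VA (inr i)), (VPrime i); rewrite /= eq_i -py.
have /enum_val_ex[w eq_w] : y \in extra_leaves (enum_val i).
  by rewrite !inE eq_i py exy.
by exists (VA (inr i)), (VNew (Tagged (fun i => 'I_(extra i)) w)); rewrite /= eqxx.
Qed.

(** An arc of the model starts at a u_i, at a lower matched vertex or at a
center, and every edge has such an endpoint: inside [D], an edge either joins
two matched partners, or joins a center to a leaf. *)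
Lemma edge_oriented x y : e x y ->
  (x \notin D \/ y \in D /\ (x \in matched_lower \/ x \in centers)) \/
  (y \notin D \/ x \in D /\ (y \in matched_lower \/ y \in centers)).
Proof.
move=> exy; have [xD|xD] := boolP (x \in D); last by left; left.
have [yD|yD] := boolP (y \in D); last by right; left.
have [xC|xC] := boolP (x \in centers); first by left; right; split; last right.
have [xL|xL] := boolP (x \in leaves e).
  right; right; split=> //; right.
  by rewrite -(leaf_partner xL exy) leaf_center.
have xS : x \notin supports e by apply: contra xC; rewrite [_ \in centers]inE xL => ->.
have xM : x \in matched by apply/matchedP.
have [pxM ppx] := matched_partner xM; have px := nonsupport_partner xD xS yD exy.
have [lo_x|lo_x] := boolP (lower x).
  by left; right; split=> //; left; rewrite inE xM.
by right; right; split=> //; left; rewrite inE -px pxM lower_partner.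
Qed.

Lemma place_edge x y : e x y ->
  exists v w, [/\ place v = x, place w = y & G v w].
Proof.
move=> exy; have [|] := edge_oriented exy.
  by case/(place_oriented exy)=> [x' [y' [<- <- arc]]]; exists x', y'; rewrite /omega_graph arc.
have eyx : e y x by rewrite e_sym.
case/(place_oriented eyx)=> [y' [x' [<- <- arc]]]; exists x', y'.
by rewrite /omega_graph arc orbT.
Qed.

Lemma place_mor (x y : omega_vert a p extra) : e (place x) (place y) = G x y.
Proof.
apply/idP/idP=> [/place_edge[x' [y' [/place_inj-> /place_inj->]]] //|].
exact: place_graph.
Qed.

(** Surjectivity comes from [place_edge], every vertex being on an edge. *)
Lemma place_bij : bijective place.
Proof.
have onto x : exists v, place v == x.
  have /card_gt0P[y] := no_isolated x; rewrite inE => /place_edge[x' [_ [<- _ _]]].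
  by exists x'.
exists (fun x => xchoose (onto x)) => x; last exact/eqP/(xchooseP (onto x)).
exact/place_inj/eqP/(xchooseP (onto (place x))).
Qed.

Lemma card_attach u : #|attach u| = r.
Proof.
have [_ _ degC _] := splitD; rewrite -(degC (enum_val u)) ?enum_valP //.
rewrite -(card_imset _ (f := fun z => place (VA z))); last first.
  by move=> z z' /place_inj[].
have uD : enum_val u \notin D by have := enum_valP u; rewrite inE.
apply: eq_card => y; rewrite inE; apply/imsetP/idP=> [[z] | euy].
  by rewrite inE => euz ->.
have [z eq_z] := place_matched_center (outside_nbh uD euy).
by exists z; rewrite ?inE eq_z.
Qed.

Lemma place_matched (z : 'I_a * bool) : place (VA (inl z)) \in matched.
Proof.
case: z => i []; have [iM _ _] := enum_matchedP i => //=.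
exact: (matched_partner iM).1.
Qed.

Lemma matched_deg x : x \in matched -> r <= #|nbh e x :&: ~: D| + 1.
Proof.
move=> /matchedP[xD xL xS]; have [_ starD _ degE] := splitD.
have := starD x xD; rewrite /star_at (negPf xS) => /eqP dD.
by rewrite addnC -dD -deg_split degE // /exposed in_setC in_setU negb_or xL.
Qed.

(** A double count of the edges between the complement of [D] and the images of
the 2a vertices of B. *)
Lemma matched_count : 2 * a * (r - 1) <= p * r.
Proof.
have [_ _ degC _] := splitD.
have -> : p * r = \sum_(x in ~: D) deg e x.
  by rewrite -sum_nat_const; apply: eq_bigr => x /degC.
set B := (fun z : 'I_a * bool => place (VA (inl z))) @: setT.
have <- : #|B| = 2 * a.
  rewrite card_imset ?cardsT ?card_prod ?card_ord ?card_bool 1?mulnC //.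
  by move=> z z' /place_inj[].
rewrite -sum_nat_const sum_deg // [leqRHS](bigID (mem B)) /=.
apply: leq_trans (leq_addr _ _); apply: leq_sum => x /imsetP[z _ ->].
by rewrite leq_subLR addnC matched_deg ?place_matched.
Qed.

Lemma star_split_Omega (x0 : T) : Omega e.
Proof.
exists a, b, r, p, extra, attach; split; split=> //.
(* Every arc of the model has an endpoint in A, so A is not empty. *)
- have /card_gt0P[y] := no_isolated x0; rewrite inE => /place_edge[x [y' [_ _]]].
  suff arc_gt0 (u v : omega_vert a p extra) : omega_arc attach u v -> 0 < a + b.
    by case/orP=> /arc_gt0.
  have gt0 (z : Avert a b) : 0 < a + b by case: z => [[[i lti] _]|[i lti]]; lia.
  case: u => [[[z|i]|u]|w] //; first by move=> _; apply: gt0 z.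
  by case: v => [[[z|i]|v]|w] // _; apply: gt0 z.
- exact: matched_count.
- exact: card_attach.
- move=> z; have [_ _ _ degE] := splitD.
  rewrite (deg_preim place_bij place_mor) degE //.
  have /matchedP[_ zL zS] := place_matched z.
  by rewrite /exposed in_setC in_setU negb_or zL.
have [f fK Kf] := place_bij.
by exists f => [|x y]; [exists place | rewrite -place_mor !Kf].
Qed.

End SplitIsOmega.

Local Open Scope ring_scope.

Theorem theorem4p6 (T : finType) (e : rel T)
    (e_sym : symmetric e) (e_irr : irreflexive e)
    (T_gt0 : (0 < #|T|)%N) (no_isolated : forall x : T, (0 < deg e x)%N) :
  let n : rat := #|T|%:R in
  let m : rat := #|edges e|%:R in
  let l : rat := #|leaves e|%:R in
  let s : rat := #|supports e|%:R in
  let d : rat := (delta_star e)%:R in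
  let gamma : rat := (doid_number e)%:R in
  gamma >= (2 * d * n - 2 * m + l - s) / (2 * d - 1) /\
  (gamma = (2 * d * n - 2 * m + l - s) / (2 * d - 1) <-> Omega e).
Proof.
move=> n m l s d gamma; have [le_gamma eq_gamma] := doid_number_bound e_sym e_irr no_isolated.
split=> //; rewrite eq_gamma; split=> [[r [D [r_gt1 splitD]]]|]; last first.
  exact: Omega_star_split.
have /card_gt0P[x0 _] := T_gt0.
exact: (star_split_Omega e_sym e_irr no_isolated r_gt1 splitD x0).
Qed.
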